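(* $$\int_0^{\infty} e^{-\mathrm{arcsinh}^2(x)}\,dx = \frac{\sqrt{\pi}}{2}\,e^{1/4}.$$
   Context: $\mathrm{arcsinh}(x)=\ln\!\left(x+\sqrt{1+x^2}\right)$ is the inverse hyperbolic sine. *)

(* Defs.v *)
From mathcomp Require Import all_boot all_order all_algebra.
From mathcomp Require Import all_classical all_reals all_analysis.

Set Implicit Arguments.
Unset Strict Implicit.
Unset Printing Implicit Defensive.

Import Order.TTheory GRing.Theory Num.Theory.
Import numFieldNormedType.Exports.

Local Open Scope ring_scope.

Definition arcsinh {R : realType} (x : R) : R :=
  ln (x + Num.sqrt (1 + x ^+ 2)).

(* Main.v *)
Require Import Defs.
From mathcomp Require Import all_boot all_order all_algebra.
From mathcomp Require Import all_classical all_reals all_analysis.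
From mathcomp Require Import measurable_realfun normal_distribution ring lra.

Import Order.TTheory GRing.Theory Num.Theory.
Import numFieldNormedType.Exports.

Local Open Scope classical_set_scope.
Local Open Scope ring_scope.

(* Substituting x = sinh t turns the integral into that of the even function
   e^{-t^2} cosh t over the half-line, i.e. half of its integral over the whole
   line; completing the square, e^{-t^2} cosh t is e^{1/4} sqrt(pi) / 2 times
   the sum of the normal densities of variance 1/2 centered at 1/2 and -1/2. *)

(* [increasing_ge0_integration_by_substitutiony] asks for a finite limit of the
   derivative at infinity, which cosh does not have. *)
Lemma ge0_integration_by_substitution0y (R : realType) (F f G : R -> R) :
  {homo F : x y / x < y} -> F 0 = 0 -> F x @[x --> +oo] --> +oo ->
  (forall x : R, is_derive x 1 F (f x)) -> continuous f -> (forall x, 0 <= f x) ->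
  continuous G -> (forall x, 0 <= G x) ->
  (\int[@lebesgue_measure R]_(x in `[0%R, +oo[) (G x)%:E =
   \int[@lebesgue_measure R]_(x in `[0%R, +oo[) (G (F x) * f x)%:E)%E.
Proof.
move=> incF F0 Fy dF cf f0 cG G0.
have F'E : derive1 F = f by apply/funext => x; rewrite derive1E derive_val.
have cF : continuous F.
  by move=> x; apply: differentiable_continuous; apply/derivable1_diffP.
have cGF : continuous (fun x => G (F x) * f x).
  by move=> x; apply: cvgM; [exact: (continuous_comp (cF x) (cG _))|exact: cf].
(* Both half-line integrals are limits of integrals over compact intervals, [[0, F n]] for [G] and
   [[0, n]] for the substituted integrand; these agree for each [n], so uniqueness of limits
   concludes. *)
have cvgR := @ge0_cvgn_integral R lebesgue_measure (fun x => G (F x) * f x)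
  (fun x => mulr_ge0 (G0 _) (f0 _)) (continuous_measurable_fun cGF).
have Fn_ndecr : nondecreasing_seq (fun n : nat => `[0, F n%:R]%classic).
  move=> m n mn; apply/subsetPset => x /=; rewrite !in_itv/= => /andP[-> xF]/=.
  by rewrite (le_trans xF)// (ltW_homo incF)// ler_nat.
have cvgL : (\int[@lebesgue_measure R]_(x in `[0%R, F n%:R]) (G x)%:E
    @[n --> \oo] --> \int[@lebesgue_measure R]_(x in `[0%R, +oo[) (G x)%:E)%E.
  (* Since [F] tends to infinity, every [x >= 0] lies below some [F n]. *)
  have -> : `[0%R, +oo[%classic = \bigcup_n `[0, F n%:R]%classic.
    apply/seteqP; split=> [x|x [n _]] /=; rewrite !in_itv/= ?andbT => x0.
      have /cvgryPge /(_ x) := cvg_comp _ _ (@cvgr_idn R) Fy.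
      case=> N _ /(_ N (leqnn _)) /= xF.
      by exists N => //=; rewrite in_itv/= x0.
    by case/andP: x0.
  apply: ge0_nondecreasing_set_cvg_integral => //.
  - move=> n; apply/measurable_EFinP/measurable_funTS.
    exact: continuous_measurable_fun.
  - by move=> n x _; rewrite lee_fin.
apply: (cvg_unique _ cvgL); first exact: ereal_hausdorff.
apply: cvg_trans cvgR; apply: near_eq_cvg; near=> n.
(* The lower bound 0 is read as [F 0] to match the substitution formula on [[0, n]]. *)
rewrite -[in RHS]F0 (@integration_by_substitution_increasing _ F G 0 n%:R)//.
- by apply: eq_integral => x _; rewrite F'E.
- by move=> x y _ _; exact: incF.
- by rewrite F'E => x _; exact: cf.
- by rewrite F'E; apply: (cvgP (f 0)); apply: cvg_at_right_filter; exact: cf.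
- by rewrite F'E; apply: (cvgP (f n%:R)); apply: cvg_at_left_filter; exact: cf.
- split.
  + by move=> x _; apply: ex_derive.
  + by apply: cvg_at_right_filter; exact: cF.
  + by apply: cvg_at_left_filter; exact: cF.
- exact: continuous_subspaceT.
Unshelve. all: end_near. Qed.

Definition sinh {R : realType} (x : R) : R := (expR x - expR (- x)) / 2.
Definition cosh {R : realType} (x : R) : R := (expR x + expR (- x)) / 2.

Section hyperbolic.
Context {R : realType}.
Implicit Types x : R.

Lemma sinh_inc : {homo @sinh R : x y / x < y}.
Proof.
move=> x y xy; rewrite /sinh ltr_pM2r//.
by apply: ltrD; rewrite ?ltrN2 ltr_expR// ltrN2.
Qed.

Lemma sinh0 : @sinh R 0 = 0.
Proof. by rewrite /sinh oppr0 subrr mul0r. Qed.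

Lemma cvgy_sinh : @sinh R x @[x --> +oo] --> +oo.
Proof.
apply/cvgryPge => A; near=> x.
have x0 : 0 <= x by near: x; apply: nbhs_pinfty_ge; exact: num_real.
(* For [x >= 0], [expR x >= 1 + x] and [expR (- x) <= 1] give [sinh x >= x / 2], hence the factor
   2. *)
have xA : 2 * A <= x by near: x; apply: nbhs_pinfty_ge; exact: num_real.
have e1 := expR_ge1Dx x.
have : expR (- x) <= 1 by rewrite expR_le1 oppr_le0.
rewrite /sinh => e2; lra.
Unshelve. all: end_near. Qed.

Lemma is_derive_sinh x : is_derive x 1 sinh (cosh x).
Proof.
rewrite /sinh; apply: is_derive_eq.
rewrite /cosh /GRing.scale/=; lra.
Qed.

Lemma cosh_ge0 x : 0 <= cosh x.
Proof. by rewrite divr_ge0// addr_ge0// expR_ge0. Qed.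

Lemma continuous_cosh : continuous (@cosh R).
Proof.
move=> x; apply: cvgM; last exact: cvg_cst.
apply: cvgD; first exact: continuous_expR.
by apply: (continuous_comp (@continuousN _ _ _ id _ _)) => //;
  exact: continuous_expR.
Qed.

(** As [1 + sinh x ^+ 2 = cosh x ^+ 2] and [cosh x >= 0], the square root is [cosh x], and
    [sinh x + cosh x = expR x]. *)
Lemma sinhK : cancel (@sinh R) arcsinh.
Proof.
move=> x; rewrite /arcsinh (_ : 1 + _ = cosh x ^+ 2).
  rewrite sqrtr_sqr ger0_norm ?cosh_ge0// (_ : sinh x + cosh x = expR x).
    exact: expRK.
  rewrite /sinh /cosh; lra.
have := expRxMexpNx_1 x; rewrite /sinh /cosh; nra.
Qed.

Lemma continuous_arcsinh : continuous (@arcsinh R).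
Proof.
move=> x.
have cs : {for x, continuous (fun x : R => x + Num.sqrt (1 + x ^+ 2))}.
  apply: cvgD; first exact: cvg_id.
  apply: (@continuous_comp _ _ _ (fun y : R => 1 + y ^+ 2) Num.sqrt);
    last exact: sqrt_continuous.
  by apply: cvgD; [exact: cvg_cst|exact: exprn_continuous].
apply: (continuous_comp cs); apply: continuous_ln.
(* The argument of [ln] is positive because [- x <= |x| = sqrt (x ^+ 2) < sqrt (1 + x ^+ 2)]. *)
rewrite -ltrBlDl sub0r (le_lt_trans (ler_norm _))// normrN -sqrtr_sqr.
by rewrite ltr_sqrt ?ltrDr// ltr_wpDr// sqr_ge0.
Qed.

End hyperbolic.

Lemma expRNsqr_cosh (R : realType) (s x : R) : s ^+ 2 = 2^-1 ->
  expR (- x ^+ 2) * cosh x =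
  Num.sqrt pi / 2 * expR (1 / 4) *
    (normal_pdf (2^-1) s x + normal_pdf (- 2^-1) s x).
Proof.
move=> s2; have s0 : s != 0.
  by apply/eqP => s0; move: s2; rewrite s0; lra.
rewrite !normal_pdfE// /normal_peak /normal_fun s2.
(* With variance 1/2 the peak is [1 / sqrt pi] and the denominator in the exponent is 1. *)
rewrite (_ : 2^-1 * pi *+ 2 = pi) 1?(_ : 2^-1 *+ 2 = 1); [|lra|lra].
have pi0 : Num.sqrt pi != 0 :> R by rewrite gt_eqF// sqrtr_gt0 pi_gt0.
have e0 : expR (1 / 4) != 0 :> R by rewrite expR_eq0.
have -> : - (x - 2^-1) ^+ 2 / 1 = - x ^+ 2 + x - 1 / 4 by field.
have -> : - (x - - 2^-1) ^+ 2 / 1 = - x ^+ 2 - x - 1 / 4 by field.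
by rewrite !expRD (expRN (1 / 4)) /cosh; field; rewrite e0 pi0.
Qed.

Lemma integral_expRNsqr_cosh (R : realType) :
  (\int[@lebesgue_measure R]_x (expR (- x ^+ 2) * cosh x)%:E =
   (Num.sqrt pi * expR (1 / 4))%:E)%E.
Proof.
pose s : R := Num.sqrt 2^-1.
have s2 : s ^+ 2 = 2^-1 by rewrite sqr_sqrtr.
under eq_integral do rewrite (expRNsqr_cosh _ s)// EFinM EFinD.
rewrite integralZl//; last first.
  by apply: integrableD => //; exact: integrable_normal_pdf.
rewrite integralD//; [|exact: integrable_normal_pdf..].
(* Each density has mass 1, so the total mass 2 cancels the 1/2 in the constant. *)
rewrite !integral_normal_pdf -EFinD -EFinM; congr EFin; lra.
Qed.

Theorem theorem3p11 (R : realType) :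
  (\int[@lebesgue_measure R]_(x in `[0%R, +oo[) (expR (- (arcsinh x) ^+ 2))%:E =
   (Num.sqrt pi / 2 * expR (1 / 4))%:E)%E.
Proof.
have cgauss : continuous (fun x : R => expR (- x ^+ 2)).
  exact: continuous_gauss_fun.
rewrite (@ge0_integration_by_substitution0y _ sinh cosh
  (fun x => expR (- (arcsinh x) ^+ 2)) sinh_inc sinh0 cvgy_sinh is_derive_sinh
  continuous_cosh cosh_ge0)//; last first.
  move=> x; apply: (@continuous_comp _ _ _ arcsinh (fun y => expR (- y ^+ 2))).
    exact: continuous_arcsinh.
  exact: cgauss.
under eq_integral do rewrite sinhK.
have := integral_expRNsqr_cosh R.
(* By evenness the whole-line integral is twice the half-line one; the factor 2 is then removed by
   multiplying the equation in the extended reals by 1/2. *)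
rewrite ge0_symfun_integralT//; last 3 first.
- by move=> x; rewrite mulr_ge0 ?expR_ge0 ?cosh_ge0.
- by move=> x; apply: cvgM; [exact: cgauss|exact: continuous_cosh].
- by move=> x /=; rewrite sqrrN /cosh opprK addrC.
rewrite -set_itvcy => /(congr1 (mule 2^-1%:E)).
rewrite muleA -!EFinM mulVf// mul1e => ->; congr EFin; lra.
Qed.
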